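(* Let $F$ be a field of arbitrary characteristic, $(B,\tau)$ a central simple associative algebra of degree $3$ with unitary involution over $F$, $J:=H(B,\tau)$, and $E$ a cubic étale $F$-algebra. Then the pair $(E,J)$ satisfies the weak Skolem-Noether property for isotopic embeddings; that is, for any two isotopic embeddings $i,i'\colon E\to J$ there exist an element $w\in E$ with $N_E(w)=1$ and an element $\varphi\in\operatorname{Str}(J)$ such that $\varphi\circ i'=i\circ R_w$.
   Context: A (unital quadratic) Jordan algebra over $F$ is an $F$-vector space $J$ with a quadratic map $x\mapsto U_x$, $J\to\operatorname{End}_F(J)$, and an element $1_J\in J$ such that, with $V_{x,y}z:=U_{x,z}y:=(U_{x+z}-U_x-U_z)y$, the identities $U_{1_J}=\mathrm{Id}_J$, $U_{U_xy}=U_xU_yU_x$, $U_xV_{y,x}=V_{x,y}U_x$ hold in all scalar extensions. Homomorphisms are linear maps preserving $U$-operators and identity elements. An element $x$ is invertible if $U_x$ is bijective, and then $x^{-1}:=U_x^{-1}x$; $J^\times$ is the set of invertible elements. For $p\in J^\times$ the $p$-isotope $J^{(p)}$ is the vector space $J$ with $U$-operator $U^{(p)}_x:=U_xU_p$ and identity element $p^{-1}$. A homotopy $J\to J'$ is a Jordan homomorphism $J\to J'^{(p')}$ for some $p'\in J'^\times$; bijective homotopies are isotopies, injective homotopies are isotopic embeddings. $\operatorname{Str}(J)$ is the group of isotopies from $J$ to itself. An associative algebra $A$ gives the Jordan algebra $A^+$ with $U_xy=xyx$ and identity $1_A$; a cubic étale algebra $E$ is identified with the Jordan algebra $E^+$,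 so $U_xy=x^2y$. $N_E$ is the norm of $E$ over $F$ and $R_w\colon E\to E$ is multiplication by $w$. A central simple associative algebra of degree $3$ with unitary involution over $F$ is an associative algebra with involution $(B,\tau)$ whose center $K$ is a quadratic étale $F$-algebra on which $\tau$ induces the nontrivial $F$-automorphism (conjugation), and which is central simple of degree $3$ over $K$ (if $K\cong F\times F$: $B\cong A\times A^{\mathrm{op}}$ with $A$ central simple of degree $3$ over $F$ and $\tau$ the exchange involution). $H(B,\tau)=\{x\in B\mid\tau(x)=x\}$ is a Jordan subalgebra of $B^+$. *)

(* Defs.v *)
From HB Require Import structures.
From mathcomp Require Import all_boot all_order all_algebra all_field.

Set Implicit Arguments.
Unset Strict Implicit.
Unset Printing Implicit Defensive.

Import GRing.Theory.

Local Open Scope ring_scope.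

(* The data (J, U, 1_J) of a unital quadratic Jordan algebra.  The Jordan
   identities are not part of the record: the notions below only involve the
   data, and they are applied to the Jordan algebras [plus_alg E] and
   [herm_alg tau] (for an involution tau). *)
Record jordan_data (F : fieldType) := JordanData {
  jcarrier :> vectType F;
  jU : jcarrier -> 'End(jcarrier);
  jone : jcarrier
}.

Arguments jone {F} j.

Section Jordan.
Variable F : fieldType.
Implicit Type J : jordan_data F.

Definition jordan_hom (J J' : jordan_data F) (f : 'Hom(J, J')) : Prop :=
  f (jone J) = jone J' /\ forall x y : J, f (jU x y) = jU (f x) (f y).

Definition jinvertible J (p : J) : Prop := bijective (jU p).

Definition jinv J (p : J) : J := (jU p)^-1%VF p.

Definition isotope J (p : J) : jordan_data F :=
  @JordanData F J (fun x => (jU x \o jU p)%VF) (jinv p).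

Definition homotopy (J J' : jordan_data F) (f : 'Hom(J, J')) : Prop :=
  exists p' : J', jinvertible p' /\ jordan_hom (J' := isotope p') f.

Definition isotopic_embedding (J J' : jordan_data F) (f : 'Hom(J, J')) : Prop :=
  homotopy f /\ injective f.

Definition isotopy (J J' : jordan_data F) (f : 'Hom(J, J')) : Prop :=
  homotopy f /\ bijective f.

Definition in_Str J (f : 'End(J)) : Prop := isotopy f.

End Jordan.

Section Algebras.
Variable F : fieldType.

Definition plus_alg (A : falgType F) : jordan_data F :=
  @JordanData F A (fun x => (amull x \o amulr x)%VF) 1.

Lemma plus_algE (A : falgType F) (x y : plus_alg A) :
  jU x y = (x : A) * (y : A) * (x : A).
Proof. by rewrite /= comp_lfunE !lfunE /= mulrA. Qed.

(* A is isomorphic to a product of finite separable field extensions of F;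
   in particular A is commutative. *)
Definition etale (A : falgType F) : Prop :=
  exists (r : nat) (L : 'I_r -> fieldExtType F)
         (f : forall k, {lrmorphism A -> L k}),
    (forall k, separable 1 {: L k}) /\
    (forall y : (forall k, L k), exists! x : A, forall k, f k x = y k).

Definition cubic_etale (E : falgType F) : Prop :=
  etale E /\ \dim {: E} = 3.

(* The norm N_A of A over F; it does not depend on the choice of a basis. *)
Definition alg_norm (A : falgType F) (x : A) : F :=
  \det (passmx.mxof (vbasis {: A}) (vbasis {: A}) (amulr x)).

Definition simple_alg (A : falgType F) : Prop :=
  forall I : {vspace A},
    ({: A} * I <= I)%VS -> (I * {: A} <= I)%VS -> I = 0%VS \/ I = fullv.

Definition central_simple3 (A : falgType F) : Prop :=
  [/\ simple_alg A, 'Z({: A})%VS = 1%VS & \dim {: A} = (3 ^ 2)%N].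

Definition involution (B : falgType F) (tau : 'End(B)) : Prop :=
  (forall x y, tau (x * y) = tau y * tau x) /\ involutive tau.

(* (B, tau) is isomorphic to A x A^op with the exchange involution. *)
Definition exchange_iso (B : falgType F) (tau : 'End(B)) (A : falgType F)
    (f : 'Hom(B, (A * A)%type)) : Prop :=
  [/\ bijective f, f 1 = (1, 1),
      forall x y, f (x * y) = ((f x).1 * (f y).1, (f y).2 * (f x).2)
    & forall x, f (tau x) = ((f x).2, (f x).1)].

(* The center K is a quadratic etale algebra, so it is either a field or
   isomorphic to F x F.  In the first disjunct B is simple, hence K is a field
   and B is central simple over K. *)
Definition unitary_central_simple3 (B : falgType F) (tau : 'End(B)) : Prop :=
  [/\ involution tau,
      etale (subvs_of 'Z({: B})),
      \dim 'Z({: B}) = 2,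
      exists2 z, z \in 'Z({: B})%VS & tau z <> z
    & (simple_alg B /\ \dim {: B} = (3 ^ 2 * \dim 'Z({: B}))%N) \/
      (exists (A : falgType F) (f : 'Hom(B, (A * A)%type)),
         central_simple3 A /\ exchange_iso tau f)].

(* The Jordan subalgebra H(B, tau) of B^+.  When tau is an involution, the
   projection vsproj is only applied to elements of H(B, tau): see
   [herm_algE] and [herm_alg1]. *)
Definition herm_alg (B : falgType F) (tau : 'End(B)) : jordan_data F :=
  @JordanData F (subvs_of (fixedSpace tau))
    (fun x => (linfun (vsproj (fixedSpace tau)) \o (amull (vsval x) \o amulr (vsval x))
                 \o linfun vsval)%VF)
    (vsproj (fixedSpace tau) 1).

Lemma herm_algE (B : falgType F) (tau : 'End(B)) (x y : herm_alg tau) :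
  involution tau -> vsval (jU x y) = vsval x * vsval y * vsval x.
Proof.
move=> [tauM _]; rewrite /= !comp_lfunE !lfunE /= mulrA vsprojK //.
by apply/fixedSpaceP; rewrite !tauM !(fixedSpaceP (subvsP _)) mulrA.
Qed.

Lemma herm_alg1 (B : falgType F) (tau : 'End(B)) :
  involution tau -> vsval (jone (herm_alg tau)) = 1.
Proof.
move=> [tauM tauK]; rewrite /= vsprojK //; apply/fixedSpaceP.
by rewrite -[LHS]mulr1 -{2}(tauK 1) -tauM mulr1 tauK.
Qed.

End Algebras.

(* Main.v *)
(** An isotopic embedding i : E -> H(B, tau) has the form x |-> j x * a with a
    invertible and hermitian and j : E -> B a Jordan homomorphism; since E is
    etale, hence spanned by orthogonal pieces generated by one element each, j is
    an algebra homomorphism.  If B is simple with center Z, the images j(E) Z and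
    j'(E) Z are copies of E (x) Z, so Skolem-Noether gives b with
    b (j' x) b^-1 = j x.  Then u = b a' tau(b) a^-1 centralizes j(E), hence lies in
    j(E) Z, and it is fixed by the involution y |-> a tau(y) a^-1, hence u = j w0
    for some w0 in E.  So h |-> b h tau(b) carries i' to i o R_w0, and a further
    structure transformation replaces w0 by w0 ^ 3 / N(w0), of norm 1.  In the
    exchange case, Skolem-Noether in the factor A gives w = 1 directly.

    Skolem-Noether and the computation of the centralizer rest on averaging with
    the separability idempotent of E, which makes complements of ideals and
    subspaces stable under E, and on the injectivity of A (x)_Z A^op -> End(A). *)
Require Import Defs.
From mathcomp Require Import all_boot all_order all_algebra all_field.
From Stdlib Require Import Classical.

Set Implicit Arguments.
Unset Strict Implicit.
Unset Printing Implicit Defensive.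

Import GRing.Theory.

Local Open Scope ring_scope.

(** * Separability idempotents of etale algebras *)

Section LinearPredicate.
Variables (F : fieldType) (U V : lmodType F) (f : U -> V).
Hypothesis f_lin : linear f.

Lemma linear_isD x y : f (x + y) = f x + f y.
Proof. by have := f_lin 1 x y; rewrite !scale1r. Qed.

Lemma linear_is0 : f 0 = 0.
Proof. by apply: (@addrI _ (f 0)); rewrite -linear_isD !addr0. Qed.

Lemma linear_isZ c x : f (c *: x) = c *: f x.
Proof. by have := f_lin c x 0; rewrite addr0 linear_is0 addr0. Qed.

Lemma linear_is_sum I (r : seq I) (P : pred I) (x : I -> U) :
  f (\sum_(k <- r | P k) x k) = \sum_(k <- r | P k) f (x k).
Proof. exact: (big_morph f linear_isD linear_is0). Qed.

End LinearPredicate.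

Section Casimir.
Variable F : fieldType.

Definition bilinear_map (U V W : lmodType F) (b : U -> V -> W) : Prop :=
  (forall y, linear (b^~ y)) /\ (forall x, linear (b x)).

(** The relation [l e = e l] in the bimodule [A (x) A]; quantifying over all bilinear maps uses the
    universal property in place of the tensor product. *)
Definition casimir_comm (A : falgType F) (s : seq (A * A)) (l : A) : Prop :=
  forall (W : lmodType F) (b : A -> A -> W), bilinear_map b ->
  \sum_(p <- s) b (l * p.1) p.2 = \sum_(p <- s) b p.1 (p.2 * l).

(* The sum of p.1 (x) p.2 over p <- s is a separability idempotent of A; tensors
   are tested on bilinear maps. *)
Definition separability_seq (A : falgType F) (s : seq (A * A)) : Prop :=
  (forall l, casimir_comm s l) /\ \sum_(p <- s) p.1 * p.2 = 1.

Lemma bilinear_comp (U V W U' V' : lmodType F) (b : U -> V -> W)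
    (f : U' -> U) (g : V' -> V) :
  linear f -> linear g -> bilinear_map b -> bilinear_map (fun x y => b (f x) (g y)).
Proof.
by move=> fl gl [bl br]; split=> [y|x] a u v; rewrite ?fl ?gl ?bl ?br.
Qed.

Lemma linear_mulr (A : falgType F) (a : A) : linear (fun x => x * a).
Proof. by move=> c x y; rewrite mulrDl scalerAl. Qed.

Lemma linear_mull (A : falgType F) (a : A) : linear (fun x => a * x).
Proof. by move=> c x y; rewrite mulrDr scalerAr. Qed.

Lemma linear_idfun (U : lmodType F) : linear (fun x : U => x).
Proof. by []. Qed.

Section Comm.
Variables (A : falgType F) (s : seq (A * A)).

Lemma casimir_comm_alg c : casimir_comm s (c%:A).
Proof.
move=> W b [bl br]; apply: eq_bigr => p _.
by rewrite -scalerAl mul1r -scalerAr mulr1 (linear_isZ (bl _)) (linear_isZ (br _)).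
Qed.

Lemma casimir_commD l l' : casimir_comm s l -> casimir_comm s l' -> casimir_comm s (l + l').
Proof.
move=> cl cl' W b b_bil; have [bl br] := b_bil.
under eq_bigr do rewrite mulrDl (linear_isD (bl _)).
under [RHS]eq_bigr do rewrite mulrDr (linear_isD (br _)).
by rewrite !big_split /= cl // cl'.
Qed.

Lemma casimir_commM l l' : casimir_comm s l -> casimir_comm s l' -> casimir_comm s (l * l').
Proof.
move=> cl cl' W b b_bil.
under eq_bigr do rewrite -mulrA.
rewrite (cl' W (fun x y => b (l * x) y)); last first.
  exact: (bilinear_comp (linear_mull l) (@linear_idfun _) b_bil).
rewrite (cl W (fun x y => b x (y * l'))); last first.
  exact: (bilinear_comp (@linear_idfun _) (linear_mulr l') b_bil).
by under eq_bigr do rewrite -mulrA.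
Qed.

(** The elements commuting with the tensor of [s] form a subalgebra, so in an algebra with one
    generator only the generator has to be checked. *)
Lemma casimir_comm_horner p l : casimir_comm s l ->
  casimir_comm s (map_poly (in_alg A) p).[l].
Proof.
move=> cl; elim/poly_ind: p => [|p c IHp].
  by rewrite rmorph0 horner0 -(scale0r 1); apply: casimir_comm_alg.
rewrite rmorphD rmorphM /= map_polyX map_polyC hornerMXaddC.
by apply: casimir_commD; [exact: casimir_commM | exact: casimir_comm_alg].
Qed.

End Comm.

(* For a separable generator t with minimal polynomial p, Euler's dual basis of
   (t ^ k) is (q_k / p'(t)), where q = p / (X - t). *)
Lemma separable_separability_seq (L : fieldExtType F) :
  separable 1 {: L} -> exists s : seq (L * L), separability_seq s.
Proof.
move=> sepL; set t := separable_generator 1 {: L}.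
have genL : {: L}%VS = <<1; t>>%VS :> {vspace L}.
  exact: eq_adjoin_separable_generator (sub1v _).
set p := minPoly 1 t.
have p't : p^`().[t] != 0.
  have /separableP/(_ t (memvf _)) := sepL.
  by rewrite /separable_element unlock => /coprimep_root; apply; exact: root_minPoly.
have [q def_p] : exists q, p = q * ('X - t%:P) by apply/factor_theorem/root_minPoly.
have p'q : p^`().[t] = q.[t].
  by rewrite def_p derivM derivXsubC mulr1 !hornerE subrr mulr0 add0r.
pose c := (p^`().[t])^-1.
exists [seq (q`_k * c, t ^+ k) | k : 'I_(size q) <- index_enum 'I_(size q)]; split.
  move=> l; have: l \in <<1; t>>%VS by rewrite -genL memvf.
  case/Fadjoin1_polyP=> f ->; apply: casimir_comm_horner.
  move=> W b [bl br]; rewrite !big_map /=; apply/eqP; rewrite eq_sym -subr_eq0; apply/eqP.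
  have [f0 def_f0] : exists f0, p = map_poly (in_alg L) f0.
    exact/polyOver1P/minPolyOver.
  have coef_p k : p`_k = (f0`_k)%:A by rewrite def_f0 coef_map.
  have szp : size p = (size q).+1.
    rewrite def_p size_Mmonic ?monicXsubC ?size_XsubC ?addn2 //.
    by apply: contra_neq p't => q0; rewrite def_p q0 mul0r deriv0 horner0.
  (* This is p(t) = 0 carried into the second argument of [b], which is possible because the
     coefficients of [p] lie in [F]. *)
  have sum0 : \sum_(k < (size q).+1) b (p`_k * c) (t ^+ k) = 0.
    under eq_bigr do rewrite coef_p -scalerAl mul1r (linear_isZ (bl _))
      -(linear_isZ (br _)).
    rewrite -(linear_is_sum (br c)).
    have -> : \sum_(k < (size q).+1) f0`_k *: t ^+ k = p.[t].
      rewrite horner_coef szp; apply: eq_bigr => k _.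
      by rewrite coef_p -scalerAl mul1r.
    by rewrite minPolyxx linear_is0.
  rewrite -[RHS]sum0.
  (* The coefficients of p = q (X - t) split the vanishing sum into the two sides of the commutation
     relation for [t]. *)
  have coef_pE k : p`_k * c = (if k == 0%N then 0 else q`_k.-1 * c) + - (t * (q`_k * c)).
    rewrite def_p mulrBr coefB coefMX coefMC mulrBl; congr (_ + _); last first.
      by rewrite [q`_k * t]mulrC mulrA.
    by case: eqP; rewrite ?mul0r.
  under [RHS]eq_bigr do rewrite coef_pE (linear_isD (bl _)) -scaleN1r
    (linear_isZ (bl _)) scaleN1r.
  rewrite big_split /= sumrN big_ord_recl /= (linear_is0 (bl _)) add0r.
  rewrite [in RHS]big_ord_recr /= [q`_(size q)]nth_default // mul0r mulr0.
  rewrite (linear_is0 (bl _)) addr0; congr (_ - _).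
  by apply: eq_bigr => k _; rewrite exprSr.
rewrite big_map /=.
under eq_bigr do rewrite mulrAC.
by rewrite -big_distrl /= -horner_coef -p'q divff.
Qed.

(** * Etale algebras as products of fields, and Jordan homomorphisms defined on them *)

Section Etale.
Variables (A : falgType F).

Section Components.
Variables (r : nat) (L : 'I_r -> fieldExtType F) (f : forall k, {lrmorphism A -> L k}).
Hypothesis f_bij : forall y : (forall k, L k), exists! x : A, forall k, f k x = y k.

Lemma components_inj x y : (forall k, f k x = f k y) -> x = y.
Proof.
by move=> eq_xy; have [z [_ z_uniq]] := f_bij (fun k => f k y); rewrite -(z_uniq y) // -(z_uniq x).
Qed.

(** [h k] is the inclusion of the factor [L k], zero in the other coordinates; it is multiplicative
    but sends 1 to an idempotent. *)
Lemma component_lift : exists h : forall k, L k -> A,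
  [/\ forall k, linear (h k), forall k, forall x y, h k (x * y) = h k x * h k y,
      forall a k x, a * h k x = h k (f k a * x) /\ h k x * a = h k (x * f k a),
      forall k m x y, k != m -> h k x * h m y = 0
    & forall a, a = \sum_k h k (f k a)].
Proof.
pose y k (x : L k) m : L m :=
  match k =P m with ReflectT e => ecast i (L i) e x | ReflectF _ => 0 end.
have yk k x : y k x k = x by rewrite /y; case: eqP => // e; rewrite eq_axiomK.
have ym k x m : k != m -> y k x m = 0 by rewrite /y; case: eqP => // ->; rewrite eqxx.
(* The condition is stated as a boolean so that [xchoose] can select the preimage. *)
have ex_h k x : exists a : A, [forall m, f m a == y k x m].
  by have [a [fa _]] := f_bij (y k x); exists a; apply/forallP=> m; apply/eqP; exact: fa.
pose h k x := xchoose (ex_h k x).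
have fh k x m : f m (h k x) = y k x m by have /forallP/(_ m)/eqP := xchooseP (ex_h k x).
have fhk k x : f k (h k x) = x by rewrite fh yk.
have fhm k x m : k != m -> f m (h k x) = 0 by rewrite fh; apply: ym.
exists h; split.
- move=> k a x x'; apply: components_inj => m; rewrite linearP /=.
  have [<-|km] := eqVneq k m; first by rewrite !fhk.
  by rewrite !fhm // scaler0 addr0.
- move=> k x x'; apply: components_inj => m; rewrite rmorphM /=.
  have [<-|km] := eqVneq k m; first by rewrite !fhk.
  by rewrite !fhm // mul0r.
- move=> a k x; split; apply: components_inj => m; rewrite rmorphM /=.
    have [<-|km] := eqVneq k m; first by rewrite !fhk.
    by rewrite !fhm // mulr0.
  have [<-|km] := eqVneq k m; first by rewrite !fhk.
  by rewrite !fhm // mul0r.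
- move=> k m x x' km; apply: components_inj => n; rewrite rmorphM rmorph0 /=.
  have [nk|kn] := eqVneq k n; last by rewrite fhm // mul0r.
  by rewrite [f n (h m x')]fhm ?mulr0 // -nk eq_sym.
- move=> a; apply: components_inj => m; rewrite linear_sum /= (bigD1 m) //= fhk.
  by rewrite big1 ?addr0 // => k km; rewrite fhm.
Qed.

End Components.

Lemma etale_comm : etale A -> commutative ( *%R : A -> A -> A).
Proof.
case=> r [L [f [_ f_bij]]] x y; apply: (components_inj f_bij) => k.
by rewrite !rmorphM /= mulrC.
Qed.

(** The separability idempotents of the factors, pushed into [A] along [h k], add up to one of [A]:
    [l] acts on the image of [h k] through [f k l], and the images of the units sum to 1. *)
Lemma etale_separability_seq : etale A -> exists s : seq (A * A), separability_seq s.
Proof.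
case=> r [L [f [sepL f_bij]]].
have [h [h_lin hM hMlr _ h_sum]] := component_lift f_bij.
have /fin_all_exists [s s_sep] k := separable_separability_seq (sepL k).
exists [seq (h k p.1, h k p.2) | k <- index_enum 'I_r, p <- s k]; split.
  move=> l W b b_bil; rewrite !big_allpairs_dep /=; apply: eq_bigr => k _.
  have [comm_s _] := s_sep k.
  under eq_bigr do rewrite (hMlr _ _ _).1.
  under [RHS]eq_bigr do rewrite (hMlr _ _ _).2.
  exact: comm_s (bilinear_comp (h_lin k) (h_lin k) b_bil).
rewrite big_allpairs_dep /= [RHS]h_sum; apply: eq_bigr => k _.
have [_ sum_s] := s_sep k; under eq_bigr do rewrite -hM.
by rewrite rmorph1 -sum_s (linear_is_sum (h_lin k)).
Qed.

(** Orthogonal idempotents go to orthogonal idempotents, which separates the factors; each factor is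
    spanned by the powers of a separable generator, and [j] preserves powers. *)
Lemma etale_jordan_hom (B : falgType F) (j : A -> B) : etale A ->
    linear j -> j 1 = 1 -> (forall x y, j (x * y * x) = j x * j y * j x) ->
  forall x y, j (x * y) = j x * j y.
Proof.
move=> etA j_lin j1 jU; have mulC := etale_comm etA.
case: etA => r [L [f [sepL f_bij]]].
have [h [h_lin hM hMlr h_orth h_sum]] := component_lift f_bij.
have j0 : j 0 = 0 by rewrite linear_is0.
have j_sqr x : j x * j x = j (x * x) by have := jU x 1; rewrite mulr1 j1 mulr1 => ->.
pose e k := h k 1.
have ehl k x : e k * h k x = h k x by rewrite -hM mul1r.
have ehr k x : h k x * e k = h k x by rewrite -hM mulr1.
have j_e k x : j (h k x) = j (e k) * j (h k x) * j (e k) by rewrite -jU ehl ehr.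
have j_ee k : j (e k) * j (e k) = j (e k) by rewrite j_sqr ehl.
have e_orth k m : k != m -> j (e k) * j (e m) = 0.
  move=> km; have jU0 : j (e k) * j (e m) * j (e k) = 0.
    by rewrite -jU h_orth // mul0r.
  (* Linearizing squares gives only anticommutation; multiplying by [j (e k)] and using [jU0] then
     gives orthogonality in every characteristic. *)
  have anti : j (e k) * j (e m) + j (e m) * j (e k) = 0.
    have := j_sqr (e k + e m).
    have -> : (e k + e m) * (e k + e m) = e k + e m.
      by rewrite mulrDl !mulrDr !ehl !h_orth // 1?eq_sym // addr0 add0r.
    rewrite (linear_isD j_lin) mulrDl !mulrDr !j_ee addrA.
    by move/addIr; rewrite -addrA -[X in _ = X]addr0 => /addrI.
  have := congr1 ( *%R (j (e k))) anti.
  by rewrite mulr0 mulrDr !mulrA j_ee jU0 addr0.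
(* Exponents start at 1 because [h k 1] is only an idempotent. The induction advances by two,
   through t^(n+3) = t t^(n+1) t, from the exponents 1 and 2. *)
have pow k t n : j (h k (t ^+ n.+1)) = j (h k t) ^+ n.+1.
  elim/ltn_ind: n => [[|[|n]]] IHn; first by rewrite !expr1.
    by rewrite !expr2 hM -j_sqr.
  rewrite exprS exprSr mulrA !hM jU IHn ?ltnS ?leqnSn //.
  by rewrite -exprS -exprSr.
have jhM k x y : j (h k (x * y)) = j (h k x) * j (h k y).
  set t := separable_generator 1 {: L k}.
  have hp z : exists p, z = \sum_(i < size p) p`_i *: t ^+ i.
    have: z \in <<1; t>>%VS.
      by rewrite -(eq_adjoin_separable_generator (sepL k) (sub1v _)) memvf.
    case/Fadjoin1_polyP=> p ->; exists p; rewrite horner_coef size_map_poly.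
    by apply: eq_bigr => i _; rewrite coef_map /= -scalerAl mul1r.
  have jh_lin : linear (fun z => j (h k z)) by move=> c z z'; rewrite h_lin j_lin.
  have j_el z : j (e k) * j (h k z) = j (h k z) by rewrite j_e !mulrA j_ee.
  have j_er z : j (h k z) * j (e k) = j (h k z) by rewrite j_e -!mulrA j_ee.
  have powM m n : j (h k (t ^+ m * t ^+ n)) = j (h k (t ^+ m)) * j (h k (t ^+ n)).
    case: m => [|m]; first by rewrite expr0 mul1r j_el.
    case: n => [|n]; first by rewrite expr0 mulr1 j_er.
    by rewrite -exprD addnS !pow -exprD addnS.
  have [p ->] := hp x; have [q ->] := hp y.
  rewrite big_distrl !(linear_is_sum jh_lin) big_distrl /=; apply: eq_bigr => m _.
  rewrite big_distrr !(linear_is_sum jh_lin) big_distrr /=; apply: eq_bigr => n _.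
  rewrite -scalerAl -scalerAr !(linear_isZ jh_lin) powM.
  by rewrite -scalerAl -scalerAr.
move=> x y.
rewrite [in LHS](h_sum x) [in RHS](h_sum x) big_distrl /= !(linear_is_sum j_lin) big_distrl /=.
apply: eq_bigr => k _; rewrite (hMlr _ _ _).2 jhM.
rewrite [in RHS](h_sum y) (linear_is_sum j_lin) big_distrr /=.
rewrite (bigD1 k) //= big1 ?addr0 // => m mk.
rewrite j_e [X in _ * X]j_e !mulrA -[_ * j (e k) * j (e m)]mulrA e_orth ?mulr0 ?mul0r //.
by rewrite eq_sym.
Qed.

End Etale.
End Casimir.

(** * Simple algebras *)

(** Excluded middle decides whether a larger value exists, and the bound [N] stops the ascent. This
    supplies subspaces of extremal dimension for undecided predicates. *)
Lemma ex_maximal (T : Type) (P : T -> Prop) (m : T -> nat) (N : nat) :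
    (forall x, P x -> (m x <= N)%N) -> (exists x, P x) ->
  exists2 x, P x & forall y, P y -> (m y <= m x)%N.
Proof.
move=> m_le [x0 Px0]; have [k] := ubnP (N - m x0)%N.
elim: k x0 Px0 => // k IHk x Px ltk.
have [[y Py lt_xy]|max_x] := classic (exists2 y, P y & (m x < m y)%N).
  apply: (IHk y Py); rewrite -ltnS; apply: leq_trans ltk.
  by rewrite ltnS ltn_sub2l // (leq_trans lt_xy) ?m_le.
exists x => // y Py; rewrite leqNgt; apply/negP=> lt_xy.
by apply: max_x; exists y.
Qed.

Section FiniteDimensionalAlgebra.
Variables (F : fieldType) (A : falgType F).
Implicit Types (U V I : {vspace A}) (a b c x y : A).

(** A scalar coefficient is absorbed by the left factor, so closure of [P] under sums is enough. *)
Lemma prodv_ind U V (P : A -> Prop) :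
    P 0 -> (forall x y, P x -> P y -> P (x + y)) ->
    (forall u v, u \in U -> v \in V -> P (u * v)) ->
  forall x, x \in (U * V)%VS -> P x.
Proof.
move=> P0 PD PM x; pose X := [seq u * v | u <- vbasis U, v <- vbasis V].
have -> : (U * V)%VS = <<in_tuple X>>%VS by rewrite unlock.
move/coord_span->; apply: big_ind => // i _; set c := coord _ _ _.
have /allpairsP[p [pU pV ->]] := mem_nth 0 (ltn_ord i).
by rewrite scalerAl; apply: PM; rewrite ?memvZ ?(vbasis_mem pU) ?(vbasis_mem pV).
Qed.

Lemma memv_center z : reflect (forall x, z * x = x * z) (z \in 'Z({: A})%VS).
Proof.
apply: (iffP memv_capP) => [[_ /centvP zC] x|zC]; first by apply: zC; apply: memvf.
by split; [apply: memvf | apply/centvP=> x _].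
Qed.

(** Right multiplication by [a] is injective, hence surjective by finite dimension, which yields a
    left inverse. *)
Lemma right_inverse_unit a x : a * x = 1 -> a \is a GRing.unit.
Proof.
move=> ax1; have ker0 : lker (amulr a) == 0%VS.
  apply/lker0P=> u v; rewrite !lfunE /= => /(congr1 ( *%R^~ x)).
  by rewrite -!mulrA ax1 !mulr1.
have /memv_imgP[y _]: 1 \in limg (amulr a) by rewrite (lker0_limgf ker0) memvf.
rewrite lfunE /= => ya1; apply/unitrP; exists x; split=> //.
have -> : x = y by rewrite -[x]mul1r ya1 -mulrA ax1 mulr1.
by [].
Qed.

Definition right_ideal I : bool := (I * {: A} <= I)%VS.

Lemma right_idealP I : reflect (forall x y, x \in I -> x * y \in I) (right_ideal I).
Proof.
apply: (iffP prodvP) => [I_id x y xI|I_id x y xI _]; last exact: I_id.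
exact: I_id (memvf y).
Qed.

Lemma right_ideal_add I V : right_ideal I -> right_ideal V -> right_ideal (I + V)%VS.
Proof. by move=> I_id V_id; rewrite /right_ideal prodvDl addvS. Qed.

Lemma right_ideal_mull U : right_ideal (U * {: A})%VS.
Proof. by rewrite /right_ideal -prodvA prodvSr ?subvf. Qed.

Lemma right_ideal_prod U I : right_ideal I -> right_ideal (U * I)%VS.
Proof. by rewrite /right_ideal -prodvA => /prodvSr; apply. Qed.

Hypothesis simpleA : simple_alg A.

Lemma simple_unit_sum d : d != 0 -> exists s : seq (A * A), \sum_(p <- s) p.1 * d * p.2 = 1.
Proof.
move=> d0; pose I := ({: A} * <[d]> * {: A})%VS.
have dI : d \in I by rewrite -[d]mul1r -[1 * d]mulr1 !memv_mul ?memvf ?memv_line.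
have [|| I0 | I1] := simpleA (I := I).
- by rewrite /I !prodvA !prodvSl ?subvf.
- exact: right_ideal_mull.
- by move: dI; rewrite I0 memv0 (negPf d0).
have: 1 \in I by rewrite I1 memvf.
apply: (prodv_ind (P := fun x => exists s : seq (A * A), \sum_(p <- s) p.1 * d * p.2 = x))
  => [|x y [s <-] [t <-]|x y /memv_cosetP[u _ ->] _].
- by exists [::]; rewrite big_nil.
- by exists (s ++ t); rewrite big_cat.
- by exists [:: (u, y)]; rewrite big_seq1.
Qed.

(** Semisimplicity: [I] has a complementary right ideal [N], and the component of 1 in [I] is a left
    identity of [I]. *)
Lemma simple_right_ideal_idempotent I : right_ideal I ->
  exists2 e, e \in I & forall x, x \in I -> e * x = x.
Proof.
move=> I_id.
have [N [N_id NI] N_max] : exists2 N, right_ideal N /\ (N :&: I = 0)%VS &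
    forall V, right_ideal V /\ (V :&: I = 0)%VS -> (\dim V <= \dim N)%N.
  apply: (ex_maximal (N := \dim {: A})) => [V _|]; first by rewrite dimvS ?subvf.
  by exists 0%VS; rewrite /right_ideal prod0v cap0v.
(* A minimal nonzero right ideal, obtained by maximizing the codimension. *)
have [S [S_id S0] S_min] : exists2 S, right_ideal S /\ S != 0%VS &
    forall V, right_ideal V /\ V != 0%VS -> (\dim {: A} - \dim V <= \dim {: A} - \dim S)%N.
  apply: (ex_maximal (N := \dim {: A})) => [V _|]; first by rewrite leq_subr.
  by exists fullv; split; [apply: subvf | apply/eqP=> f0; have := memvf (1 : A);
    rewrite f0 memv0 oner_eq0].
have full : (I + N)%VS = fullv.
  apply/eqP; rewrite eqEsubv subvf /=.
  (* [A S] is a nonzero two-sided ideal, hence all of [A]; so [I + N] is full as soon as it contains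
     every [x S]. *)
  have [all_S|[x xS]] : (forall x, (<[x]> * S <= I + N)%VS) \/
      exists x, ~~ (<[x]> * S <= I + N)%VS.
  - have [|h] := classic (exists x, ~~ (<[x]> * S <= I + N)%VS); first by right.
    by left=> x; apply/negPn/negP=> xS; apply: h; exists x.
  - have [|| fS0 | <-] := simpleA (I := ({: A} * S)%VS).
    + by rewrite prodvA prodvSl ?subvf.
    + exact: right_ideal_prod.
    + case/negP: S0; rewrite -subv0 -fS0; apply/subvP=> v vS.
      by rewrite -[v]mul1r memv_mul ?memvf.
    by apply/prodvP=> x v _ vS; apply: (subvP (all_S x)); rewrite memv_mul ?memv_line.
  (* [T] is a right ideal, proper in [S] by the choice of [x], hence 0 by minimality. Then [N + x S]
     still meets [I] in 0, against the maximality of [N]. *)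
  pose T := (S :&: (amull x @^-1: (I + N)))%VS.
  have memT v : v \in T = (v \in S) && (x * v \in (I + N)%VS).
    by rewrite memv_cap -memv_preim lfunE.
  have IN_id : right_ideal (I + N)%VS by apply: right_ideal_add.
  have T_id : right_ideal T.
    apply/right_idealP=> u v; rewrite !memT => /andP[uS xu].
    by rewrite mulrA !(right_idealP _ _ _ v).
  have T0 : T = 0%VS.
    apply/eqP; apply/negPn/negP=> T0; have := S_min T (conj T_id T0).
    rewrite leq_sub2lE ?(dimvS (subvf S)) // => le_ST.
    have /eqP eqTS : T == S by rewrite -(dimv_leqif_eq (capvSl _ _)) eqn_leq le_ST dimvS ?capvSl.
    case/negP: xS; apply/prodvP=> _ v /vlineP[c ->] vS.
    by rewrite -scalerAl memvZ //; move: vS; rewrite -eqTS memT => /andP[].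
  have xS_IN v : v \in S -> x * v \in (I + N)%VS -> v = 0.
    by move=> vS xv; apply/eqP; rewrite -memv0 -T0 memT vS.
  pose V := (N + <[x]> * S)%VS.
  have V_id : right_ideal V by rewrite right_ideal_add // right_ideal_prod.
  have VI : (V :&: I = 0)%VS.
    apply/eqP; rewrite -subv0; apply/subvP=> w /memv_capP[/memv_addP[u uN [w' w'S ->]] wI].
    have [v vS def_w'] : exists2 v, v \in S & w' = x * v.
      move: w'S; apply: (prodv_ind (P := fun w => exists2 v, v \in S & w = x * v))
        => [|y z [v vS ->] [v' v'S ->]|_ v /vlineP[c ->] vS].
      - by exists 0; rewrite ?mem0v ?mulr0.
      - by exists (v + v'); rewrite ?memvD ?mulrDr.
      - by exists (c *: v); rewrite ?memvZ // -scalerAl scalerAr.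
    have v0 : v = 0.
      apply: xS_IN => //; rewrite -def_w' -[w'](addKr u) addrC.
      by apply/memv_addP; exists (u + w') => //; exists (- u); rewrite ?memvN.
    move: wI; rewrite def_w' v0 mulr0 addr0 => uI.
    by rewrite -NI memv_cap uN.
  have /eqP eqNV : N == V.
    by rewrite -(dimv_leqif_eq (addvSl _ _)) eqn_leq (N_max V) // dimvS ?addvSl.
  case/negP: xS; apply: subv_trans (addvSr I N).
  by rewrite eqNV addvSr.
have: 1 \in (I + N)%VS by rewrite full memvf.
case/memv_addP=> e eI [n nN def1]; exists e => // x xI.
have nx : n * x \in (N :&: I)%VS.
  rewrite memv_cap (right_idealP _ N_id) //= -[n](addKr e) -def1 mulrDl mul1r mulNr.
  by rewrite memvD ?memvN ?(right_idealP _ I_id).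
have: x = e * x + n * x by rewrite -mulrDl -def1 mul1r.
by move: nx; rewrite NI memv0 => /eqP->; rewrite addr0.
Qed.

(* Injectivity of A (x)_Z A^op -> End(A) for the center Z of A, on tensors
   written with second factors independent over Z. *)
Lemma simple_independent_mull n (a b : 'I_n -> A) :
    (forall z : 'I_n -> A, (forall k, z k \in 'Z({: A})%VS) ->
       \sum_k z k * b k = 0 -> forall k, z k = 0) ->
    (forall c, \sum_k a k * c * b k = 0) ->
  forall k, a k = 0.
Proof.
move=> b_indep; have [m] := ubnP #|[set k | a k != 0]|.
elim: m a => // m IHm a lt_m sum0 k; apply/eqP/negPn/negP => ak0.
have [s sum_s] := simple_unit_sum ak0.
(* The relation is transformed so that its coefficient at [k] becomes 1. *)
pose a' i := \sum_(p <- s) p.1 * a i * p.2.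
have a'_supp i : a i = 0 -> a' i = 0.
  by move=> ai0; apply: big1 => p _; rewrite ai0 mulr0 mul0r.
have sum0' c : \sum_i a' i * c * b i = 0.
  under eq_bigr do rewrite !big_distrl /=.
  rewrite exchange_big big1 //= => p _.
  rewrite -[RHS](mulr0 p.1) -[in RHS](sum0 (p.2 * c)) big_distrr /=.
  by apply: eq_bigr => i _; rewrite !mulrA.
(* The commutators of the [a' i] with [x] satisfy the same kind of relation, and they vanish at [k]
   and wherever [a] does; the induction hypothesis makes them 0. *)
have a'_center i : a' i \in 'Z({: A})%VS.
  apply/memv_center=> x; apply/eqP; rewrite -subr_eq0; apply/eqP; move: i.
  apply: IHm => [|c].
    rewrite -ltnS; apply: leq_trans lt_m; rewrite ltnS; apply: proper_card.
    apply/properP; split; last by exists k; rewrite !inE // /a' sum_s mul1r mulr1 subrr eqxx.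
    apply/subsetP=> i; rewrite !inE; apply: contra_neq => ai0.
    by rewrite a'_supp // mul0r mulr0 subrr.
  under eq_bigr do rewrite !mulrBl.
  rewrite big_split /= sumrN -[X in _ = X](subrr 0); congr (_ - _).
    by rewrite -[RHS](sum0' (x * c)); apply: eq_bigr => i _; rewrite !mulrA.
  by rewrite -[RHS](mulr0 x) -[in RHS](sum0' c) big_distrr; apply: eq_bigr => i _; rewrite /= !mulrA.
have sum1 : \sum_i a' i * b i = 0.
  by rewrite -[RHS](sum0' 1); apply: eq_bigr => i _; rewrite mulr1.
have /eqP := b_indep a' a'_center sum1 k.
by rewrite /a' sum_s oner_eq0.
Qed.

End FiniteDimensionalAlgebra.

(** * Centralizers and the Skolem-Noether theorem *)

Section Embeddings.
Variables (F : fieldType) (A E : falgType F).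
Local Notation Z := ('Z({: A}))%VS.
Local Notation n := (\dim {: E}).
Local Notation y := (vbasis {: E}).

Definition alg_hom (j : 'Hom(E, A)) : Prop :=
  j 1 = 1 /\ forall u v, j (u * v) = j u * j v.

(* The extension E (x) Z -> A of j is injective. *)
Definition center_independent (j : 'Hom(E, A)) : Prop :=
  forall z : 'I_n -> A, (forall k, z k \in Z) ->
    \sum_k z k * j y`_k = 0 -> forall k, z k = 0.

Hypothesis simpleA : simple_alg A.
Hypothesis dimA : \dim {: A} = (n ^ 2 * \dim Z)%N.
Hypothesis commE : commutative ( *%R : E -> E -> E).
Variables (sE : seq (E * E)) (sZ : seq (A * A)).
Hypothesis sepE : separability_seq sE.
Hypothesis sZ_comm : forall z, z \in Z -> casimir_comm sZ z.
Hypothesis sZ_sum : \sum_(p <- sZ) p.1 * p.2 = 1.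
Hypothesis sZ_center : forall p, p \in sZ -> (p.1 \in Z) && (p.2 \in Z).

Lemma center1 : 1 \in Z.
Proof. by apply/memv_center=> x; rewrite mul1r mulr1. Qed.

Lemma basis_sum (x : E) : x = \sum_k coord y k x *: y`_k.
Proof. exact/coord_vbasis/memvf. Qed.

(** * The commutative subalgebra L = Z j(E) and its centralizer *)

Section Centralizer.
Variable j : 'Hom(E, A).
Hypothesis j_hom : alg_hom j.
Hypothesis j_indep : center_independent j.

Let J := (j @: {: E})%VS.
Let L := (Z * J)%VS.
Let l (k : 'I_n) : A := j y`_k.

Let j1 : j 1 = 1. Proof. by case: j_hom. Qed.
Let jM u v : j (u * v) = j u * j v. Proof. by case: j_hom. Qed.

Let j_J x : j x \in J. Proof. by rewrite memv_img ?memvf. Qed.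

Let ZJ_comm : (J * Z = Z * J)%VS.
Proof.
apply/eqP; rewrite eqEsubv; apply/andP; split; apply/prodvP=> u v.
  by move=> uJ vZ; rewrite -(memv_center _ vZ) memv_mul.
by move=> uZ vJ; rewrite (memv_center _ uZ) memv_mul.
Qed.

Let JJ : (J * J <= J)%VS.
Proof.
by apply/prodvP=> _ _ /memv_imgP[u _ ->] /memv_imgP[v _ ->]; rewrite -jM j_J.
Qed.

Let LL : (L * L <= L)%VS.
Proof.
rewrite /L -prodvA [(J * _)%VS]prodvA ZJ_comm -[(_ * _ * J)%VS]prodvA prodvA prodvS //.
by apply/prodvP=> u v /memv_center uZ /memv_center vZ; apply/memv_center=> x;
  rewrite -mulrA vZ mulrA uZ mulrA.
Qed.

Let LM u v : u \in L -> v \in L -> u * v \in L.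
Proof. by move=> uL vL; apply: (subvP LL); rewrite memv_mul. Qed.

Let Z_L z : z \in Z -> z \in L.
Proof. by move=> zZ; rewrite -[z]mulr1 memv_mul // -j1. Qed.

Let j_L x : j x \in L.
Proof. by rewrite -[j x]mul1r memv_mul ?center1. Qed.

Let L_comm u v : u \in L -> v \in L -> u * v = v * u.
Proof.
have jj a b : j a * j b = j b * j a by rewrite -!jM commE.
move=> uL; move: v; move: u uL; apply: (prodv_ind (P := fun u => forall v, v \in L -> u * v = v * u)).
- by move=> v _; rewrite mul0r mulr0.
- by move=> a b Ca Cb v vL; rewrite mulrDl mulrDr Ca // Cb.
move=> z _ /memv_center zC /memv_imgP[a _ ->].
apply: prodv_ind; first by rewrite mul0r mulr0.
  by move=> b c Cb Cc; rewrite mulrDl mulrDr Cb // Cc.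
move=> z' _ /memv_center zC' /memv_imgP[b _ ->].
rewrite -!mulrA [j a * _]mulrA -(zC' (j a)) [j b * _]mulrA -(zC (j b)) -!mulrA jj.
by rewrite !mulrA (zC z').
Qed.

Lemma center_span_sum u : u \in (Z * (j @: {: E}))%VS ->
  exists2 z : 'I_n -> A, (forall k, z k \in Z) & u = \sum_k z k * j y`_k.
Proof.
apply: (prodv_ind (P := fun u => exists2 z : 'I_n -> A,
  (forall k, z k \in Z) & u = \sum_k z k * j y`_k))
  => [|u1 u2 [z zZ ->] [t tZ ->]|z _ zZ /memv_imgP[x _ ->]].
- exists (fun=> 0) => [k|]; first exact: mem0v.
  by rewrite big1 // => k _; rewrite mul0r.
- exists (fun k => z k + t k) => [k|]; first by rewrite memvD.
  by rewrite -big_split; apply: eq_bigr => k _; rewrite mulrDl.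
exists (fun k => coord y k x *: z) => [k|]; first by rewrite memvZ.
rewrite [in LHS](basis_sum x) linear_sum big_distrr; apply: eq_bigr => k _.
by rewrite /= linearZ -scalerAr scalerAl.
Qed.

Let dimL : \dim L = (n * \dim Z)%N.
Proof.
have dimZl k : \dim (Z * <[l k]>)%VS = \dim Z.
  rewrite -limg_amulr limg_dim_eq //; apply/eqP; rewrite -subv0.
  apply/subvP=> z /memv_capP[zZ]; rewrite memv_ker lfunE /= => /eqP zl0.
  pose t m := if m == k then z else 0.
  have -> : z = t k by rewrite /t eqxx.
  rewrite memv0 (j_indep (z := t)) // => [m|]; first by rewrite /t; case: ifP; rewrite ?mem0v.
  rewrite (bigD1 k) //= {1}/t eqxx [z * _]zl0 add0r big1 // => m /negPf mk.
  by rewrite /t mk mul0r.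
have -> : L = (\sum_k Z * <[l k]>)%VS.
  apply/eqP; rewrite eqEsubv; apply/andP; split.
    apply/subvP=> u /center_span_sum[z zZ ->]; apply/memv_sumP.
    by exists (fun k => z k * l k) => // k _; rewrite memv_mul ?memv_line.
  by apply/subv_sumP=> k _; rewrite prodvSr // -memvE j_J.
rewrite (directvP _) /=; first by under eq_bigr do rewrite dimZl; rewrite sum_nat_const card_ord.
apply/directv_sum_independent=> us us_in sum0 k _.
have /fin_all_exists2 [z zZ zl] m : exists2 z, z \in Z & us m = z * l m.
  by have /memv_cosetP[z zZ ->] := us_in m isT; exists z.
rewrite zl (j_indep zZ) ?mul0r // -[RHS]sum0.
by apply: eq_bigr => m _; rewrite zl.
Qed.

(** The product of the separability idempotents of j(E) and of the center is one for [L]. *)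
Let sL := [seq (j p.1 * q.1, j p.2 * q.2) | p <- sE, q <- sZ].

Let sL_comm u : u \in L -> casimir_comm sL u.
Proof.
apply: prodv_ind => [|a b Ca Cb|z _ zZ /memv_imgP[x _ ->]].
- by rewrite -(scale0r 1); apply: casimir_comm_alg.
- exact: casimir_commD.
apply: casimir_commM => W b b_bil; rewrite !big_allpairs_dep /=.
  apply: eq_bigr => p _; have zC := memv_center _ zZ.
  under eq_bigr do rewrite mulrA zC -mulrA.
  rewrite (sZ_comm zZ (b := fun u v => b (j p.1 * u) (j p.2 * v))) /=.
    by apply: eq_bigr => q _; rewrite mulrA.
  exact: (bilinear_comp (linear_mull _) (linear_mull _) b_bil).
rewrite exchange_big [RHS]exchange_big /=; apply: eq_big_seq => q /sZ_center/andP[q1Z q2Z].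
under eq_bigr do rewrite mulrA -jM.
rewrite (sepE.1 x _ (fun u v => b (j u * q.1) (j v * q.2))) /=.
  apply: eq_bigr => p _; by rewrite jM -!mulrA (memv_center _ q2Z).
by apply: bilinear_comp b_bil => c e f; rewrite linearP mulrDl scalerAl.
Qed.

Let sL_sum : \sum_(p <- sL) p.1 * p.2 = 1.
Proof.
rewrite big_allpairs_dep /= exchange_big /= -[RHS]sZ_sum; apply: eq_big_seq => q /sZ_center/andP[q1Z _].
under eq_bigr do rewrite mulrA -[_ * q.1 * _]mulrA (memv_center _ q1Z) mulrA -jM -mulrA.
by rewrite -big_distrl /= -linear_sum /= sepE.2 j1 mul1r.
Qed.

Let sL_L p : p \in sL -> (p.1 \in L) && (p.2 \in L).
Proof.
case/allpairsP=> -[p' q] [_ /sZ_center/andP[q1Z q2Z] ->] /=.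
by rewrite !LM ?j_L ?Z_L.
Qed.

Let N a := (L * <[a]> * L)%VS.

(** Central coefficients on the right of [a] move to the left, so only the basis elements [l k]
    remain there. *)
Let N_sum a x : x \in N a ->
  exists2 r : 'I_n -> A, (forall k, r k \in L) & x = \sum_k r k * a * l k.
Proof.
apply: (prodv_ind (P := fun x =>
  exists2 r : 'I_n -> A, (forall k, r k \in L) & x = \sum_k r k * a * l k)).
- exists (fun=> 0) => [k|]; first exact: mem0v.
  by rewrite big1 // => k _; rewrite !mul0r.
- move=> _ _ [r rL ->] [s sL' ->]; exists (fun k => r k + s k) => [k|]; first by rewrite memvD.
  by rewrite -big_split; apply: eq_bigr => k _; rewrite !mulrDl.
move=> _ v /memv_cosetP[u uL ->] /center_span_sum[z zZ ->].
exists (fun k => u * z k) => [k|]; first exact: LM uL (Z_L (zZ k)).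
by rewrite big_distrr; apply: eq_bigr => k _; rewrite /= mulrA -[_ * a * z k]mulrA -(memv_center _ (zZ k)) !mulrA.
Qed.

Let N_gen a u v : u \in L -> v \in L -> u * a * v \in N a.
Proof. by move=> uL vL; rewrite !memv_mul ?memv_line. Qed.

Let N_bimod a u v x : u \in L -> v \in L -> x \in N a -> u * x * v \in N a.
Proof.
move=> uL vL /N_sum[r rL ->]; rewrite big_distrr big_distrl memv_suml //= => k _.
by rewrite !mulrA -mulrA N_gen ?LM ?rL ?j_L.
Qed.

(** A linear projection onto [N a], averaged on both sides by [sL] as in Maschke's theorem; the
    result is an [L]-bimodule projection onto [N a]. *)
Let pi a : 'End(A) := \sum_(s <- sL) \sum_(t <- sL)
  (amulr t.2 \o amull s.1 \o projv (N a) \o amulr t.1 \o amull s.2)%VF.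

Let piE a c : pi a c = \sum_(s <- sL) \sum_(t <- sL) s.1 * projv (N a) (s.2 * c * t.1) * t.2.
Proof.
rewrite /pi sum_lfunE; apply: eq_bigr => s _.
by rewrite sum_lfunE; apply: eq_bigr => t _; rewrite !comp_lfunE !lfunE.
Qed.

Let pi_bimod a u v c : u \in L -> v \in L -> pi a (u * c * v) = u * pi a c * v.
Proof.
move=> uL vL.
have pil x : pi a (u * x) = u * pi a x.
  pose b p q := \sum_(t <- sL) p * projv (N a) (q * x * t.1) * t.2.
  have b_bil : bilinear_map b.
    split=> [q|p] e f g; rewrite /b scaler_sumr -big_split /=; apply: eq_bigr => t _.
      by rewrite !mulrDl -!scalerAl.
    by rewrite !mulrDl -!scalerAl linearP mulrDr mulrDl -scalerAr -scalerAl.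
  transitivity (\sum_(s <- sL) b s.1 (s.2 * u)).
    by rewrite piE; apply: eq_bigr => s _; apply: eq_bigr => t _; rewrite !mulrA.
  rewrite -(sL_comm uL b_bil) piE big_distrr; apply: eq_bigr => s _.
  by rewrite /b big_distrr; apply: eq_bigr => t _; rewrite /= !mulrA.
have pir x : pi a (x * v) = pi a x * v.
  rewrite !piE big_distrl; apply: eq_bigr => s _ /=.
  pose b p q := s.1 * projv (N a) (s.2 * x * p) * q.
  have b_bil : bilinear_map b.
    split=> [q|p] e f g; rewrite /b.
      by rewrite mulrDr -scalerAr linearP mulrDr mulrDl -scalerAr -scalerAl.
    by rewrite mulrDr -scalerAr.
  transitivity (\sum_(t <- sL) b (v * t.1) t.2).
    by apply: eq_bigr => t _; rewrite /b !mulrA.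
  rewrite (sL_comm vL b_bil) big_distrl; apply: eq_bigr => t _.
  by rewrite /b /= !mulrA.
by rewrite pir pil.
Qed.

Let pi_N a c : pi a c \in N a.
Proof.
rewrite piE big_seq memv_suml // => s /sL_L/andP[s1 s2].
rewrite big_seq memv_suml // => t /sL_L/andP[t1 t2].
by rewrite N_bimod ?memv_proj.
Qed.

Let pi_id a c : c \in N a -> pi a c = c.
Proof.
move=> cN; rewrite piE -[RHS]mul1r -sL_sum big_distrl /=; apply: eq_big_seq => s /sL_L/andP[s1 s2].
rewrite -[RHS]mulr1 -[in RHS]sL_sum big_distrr /=; apply: eq_big_seq => t /sL_L/andP[t1 t2].
by rewrite projv_id ?N_bimod // !mulrA.
Qed.



(** Since [L] is commutative, a relation satisfied by a generator passes to the whole bimodule. *)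
Let N_kill a (r : 'I_n -> A) x : (forall k, r k \in L) ->
  \sum_k r k * a * l k = 0 -> x \in N a -> \sum_k r k * x * l k = 0.
Proof.
move=> rL sum0 /N_sum[q qL ->].
under eq_bigr do rewrite big_distrr big_distrl /=.
rewrite exchange_big big1 //= => m _.
transitivity (q m * (\sum_k r k * a * l k) * l m); last by rewrite sum0 mulr0 mul0r.
rewrite big_distrr big_distrl /=.
apply: eq_bigr => k _.
rewrite -!mulrA (L_comm (j_L _) (j_L _)) !mulrA; congr (_ * _ * _ * _).
exact: L_comm.
Qed.

Let L1 : 1 \in L. Proof. exact: Z_L center1. Qed.

Let a_N a : a \in N a.
Proof. by have := N_gen a L1 L1; rewrite mul1r mulr1. Qed.

Let L_indep_l (r : 'I_n -> A) :
  (forall c, \sum_k r k * c * l k = 0) -> forall k, r k = 0.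
Proof. exact: simple_independent_mull. Qed.

(* If r annihilates a but not c, adding to a the component of c in an
   L-bimodule complement of L a L enlarges L a L. *)
Let cyclic_bimodule : exists a, N a = {: A}%VS.
Proof.
have [a _ a_max] : exists2 a, True & forall b, True -> (\dim (N b) <= \dim (N a))%N.
  by apply: (ex_maximal (N := \dim {: A})) => [b _|]; [rewrite dimvS ?subvf | exists 0].
exists a.
have r0 (r : 'I_n -> A) : (forall k, r k \in L) -> \sum_k r k * a * l k = 0 -> forall k, r k = 0.
  move=> rL sum_a; apply: L_indep_l => c; apply/eqP/negPn/negP=> sum_c.
  pose b := c - pi a c; pose a' := a + b.
  have pi_b : pi a b = 0.
    by rewrite linearB /= [pi a (pi a c)]pi_id // subrr.
  have pi_a' : pi a a' = a by rewrite linearD /= pi_b addr0 pi_id.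
  pose S := \sum_k r k * a' * l k.
  have S0 : S != 0.
    suff -> : S = \sum_k r k * c * l k by [].
    transitivity (\sum_k r k * a * l k + (\sum_k r k * c * l k - \sum_k r k * pi a c * l k)).
      rewrite -sumrB -big_split; apply: eq_bigr => k _.
      by rewrite /a' /b !mulrDr !mulrDl !mulrN !mulNr.
    by rewrite sum_a (N_kill rL sum_a (pi_N a c)) subr0 add0r.
  have S_N : S \in N a' by rewrite memv_suml // => k _; exact: N_gen (rL k) (j_L _).
  pose f := pi a.
  have f_S : S \in lker f.
    rewrite memv_ker linear_sum /=.
    under eq_bigr => k _ do rewrite (pi_bimod a a' (rL k) (j_L _)) pi_a'.
    by rewrite sum_a.
  (* [pi a] maps [N a'] onto [N a] and kills the nonzero element [S], so [N a'] has larger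
     dimension. *)
  have N_f : (N a <= f @: N a')%VS.
    apply/subvP=> x /N_sum[q qL ->]; apply/memv_imgP.
    exists (\sum_k q k * a' * l k); first by rewrite memv_suml // => k _; exact: N_gen (qL k) (j_L _).
    rewrite linear_sum; apply: eq_bigr => k _.
    by rewrite /= (pi_bimod a a' (qL k) (j_L _)) pi_a'.
  have := a_max a' I; rewrite leqNgt => /negP; apply.
  rewrite -(limg_ker_dim f (N a')) -add1n leq_add ?dimvS //.
  rewrite lt0n dimv_eq0; apply: contra_neq S0 => ker0.
  by apply/eqP; rewrite -memv0 -ker0 memv_cap S_N.
(* By [r0] the bimodule [N a] contains the direct sum of n copies of [L], whose dimension is already
   that of [A]. *)
apply/eqP; rewrite eqEdim subvf dimA /=.
pose G k := (L * <[a * l k]>)%VS.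
have dimG k : \dim (G k) = (n * \dim Z)%N.
  rewrite /G -limg_amulr limg_dim_eq //; apply/eqP; rewrite -subv0.
  apply/subvP=> u /memv_capP[uL]; rewrite memv_ker lfunE /= => /eqP u0.
  pose t m := if m == k then u else 0.
  have -> : u = t k by rewrite /t eqxx.
  rewrite memv0 (r0 t) // => [m|]; first by rewrite /t; case: ifP; rewrite ?mem0v.
  rewrite (bigD1 k) //= {1}/t eqxx -mulrA [u * _]u0 add0r big1 // => m /negPf mk.
  by rewrite /t mk !mul0r.
have <- : (\sum_k \dim (G k) = n ^ 2 * \dim Z)%N.
  by under eq_bigr do rewrite dimG; rewrite sum_nat_const card_ord mulnA.
have dirG : directv (\sum_k G k).
  apply/directv_sum_independent=> us us_in sum0 k _.
  have /fin_all_exists2 [r rL ru] m : exists2 u, u \in L & us m = u * (a * l m).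
    by have /memv_cosetP[u uL ->] := us_in m isT; exists u.
  rewrite ru (r0 r rL) ?mul0r // -[RHS]sum0.
  by apply: eq_bigr => m _; rewrite ru mulrA.
move/directvP: dirG => /= <-; apply: dimvS; apply/subv_sumP=> k _.
by apply/subvP=> _ /memv_cosetP[u uL ->]; rewrite mulrA; exact: N_gen uL (j_L _).
Qed.

(** With A = L a L, the product [c a] equals a sum of [r k * a * l k] with coefficients in [L];
    comparing coefficients puts [c] itself in [L]. *)
Lemma centralizer_embedding c : (forall x, c * j x = j x * c) ->
  exists2 z : 'I_n -> A, (forall k, z k \in Z) & c = \sum_k z k * j y`_k.
Proof.
move=> c_j; apply: center_span_sum.
have cL u : u \in L -> c * u = u * c.
  apply: (prodv_ind (P := fun u => c * u = u * c))
    => [|v w Cv Cw|z _ /memv_center zC /memv_imgP[x _ ->]].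
  - by rewrite mulr0 mul0r.
  - by rewrite mulrDr mulrDl Cv Cw.
  - by rewrite mulrA -zC -!mulrA c_j.
have [a Na] := cyclic_bimodule.
have [r rL ca] : exists2 r : 'I_n -> A, (forall k, r k \in L) & c * a = \sum_k r k * a * l k.
  by apply: N_sum; rewrite Na memvf.
have [z zZ def1] := center_span_sum L1.
(* The [d k] annihilate [a] and commute with [L], so they annihilate L a L = A and vanish; hence
   each [c * z k] lies in [L]. *)
pose d k := c * z k - r k.
have d_sum : \sum_k d k * a * l k = 0.
  under eq_bigr do rewrite !mulrBl.
  rewrite sumrB -ca -[c * a]mulr1 def1 big_distrr /=; apply/eqP; rewrite subr_eq0; apply/eqP.
  apply: eq_bigr => k _; rewrite -!mulrA; congr (_ * _).
  by rewrite !mulrA (memv_center _ (zZ k)).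
have dL k u : u \in L -> d k * u = u * d k.
  move=> uL; rewrite mulrBl mulrBr; congr (_ - _); last exact: L_comm.
  by rewrite -mulrA (memv_center _ (zZ k)) mulrA (cL u uL) -!mulrA.
have d0 : forall k, d k = 0.
  apply: L_indep_l => x; have [q qL ->] : exists2 q : 'I_n -> A, (forall k, q k \in L)
      & x = \sum_k q k * a * l k by apply: N_sum; rewrite Na memvf.
  under eq_bigr do rewrite big_distrr big_distrl /=.
  rewrite exchange_big big1 //= => m _.
  transitivity (q m * (\sum_k d k * a * l k) * l m); last by rewrite d_sum mulr0 mul0r.
rewrite big_distrr big_distrl /=.
  apply: eq_bigr => k _.
  by rewrite -!mulrA (L_comm (j_L _) (j_L _)) !mulrA dL.
rewrite -[c]mulr1 def1 big_distrr memv_suml // => k _.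
rewrite /= mulrA; have /eqP := d0 k; rewrite subr_eq0 => /eqP->.
by rewrite LM.
Qed.

End Centralizer.

(** * Conjugacy of two embeddings of [E] *)

Section SkolemNoether.
Variables j j' : 'Hom(E, A).
Hypotheses (j_hom : alg_hom j) (j'_hom : alg_hom j').
Hypotheses (j_indep : center_independent j) (j'_indep : center_independent j').

Let average c : A := \sum_(p <- sE) j p.1 * c * j' p.2.

Let intertwines b : Prop := forall x, j x * b = b * j' x.

Let average_intertwines c : intertwines (average c).
Proof.
move=> x; rewrite /average big_distrr big_distrl /=.
transitivity (\sum_(p <- sE) j (x * p.1) * c * j' p.2).
  by apply: eq_bigr => p _; rewrite j_hom.2 !mulrA.
rewrite (sepE.1 x _ (fun u v => j u * c * j' v)).
  by apply: eq_bigr => p _; rewrite j'_hom.2 !mulrA.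
split=> [v|u] e f g; first by rewrite linearP !mulrDl -!scalerAl.
by rewrite linearP mulrDr -scalerAr.
Qed.

(** If every [e * average c] were 0, the tensor of the [e * j p.1] and [j' p.2] would act as 0 on
    [A], hence vanish by the independence of j'(E) over the center. *)
Let average_neq0 e : e != 0 -> exists c, e * average c != 0.
Proof.
move=> e0; apply: NNPP => no_c; case/eqP: e0.
pose r k := \sum_(p <- sE) coord y k p.2 *: (e * j p.1).
have r0 : forall k, r k = 0.
  apply: (simple_independent_mull simpleA (b := fun k => j' y`_k)) => // c.
  transitivity (e * average c); last first.
    by apply/eqP/negPn/negP=> c0; apply: no_c; exists c.
  under eq_bigr do rewrite !big_distrl /=.
  rewrite exchange_big big_distrr; apply: eq_bigr => p _ /=.
  rewrite [in RHS](basis_sum p.2) linear_sum !big_distrr /=; apply: eq_bigr => k _.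
  by rewrite linearZ -!scalerAl -!scalerAr !mulrA.
(* The equations [r k = 0] do not mention [j'], so the [r k] may be paired with [j]; the sum then
   collapses to [e] by the normalization of [sE]. *)
rewrite -[e]mulr1 -j_hom.1 -sepE.2 linear_sum big_distrr /=.
transitivity (\sum_k r k * j y`_k); last by apply: big1 => k _; rewrite r0 mul0r.
under [RHS]eq_bigr do rewrite big_distrl /=.
rewrite [RHS]exchange_big; apply: eq_bigr => p _ /=.
rewrite j_hom.2 [in LHS](basis_sum p.2) linear_sum !big_distrr /=; apply: eq_bigr => k _.
by rewrite linearZ -!scalerAl -!scalerAr !mulrA.
Qed.

(* The right ideal of an intertwiner a is generated by an idempotent p of the
   centralizer of j(E), which is the span of j(E) over the center; if p <> 1, an
   intertwiner in (1 - p) A can be added to a. *)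
Lemma skolem_noether : exists2 b, b \is a GRing.unit & forall x, j x * b = b * j' x.
Proof.
pose R a := (<[a]> * {: A})%VS.
have R_mem a v : a * v \in R a by rewrite memv_mul ?memv_line ?memvf.
have RP a v : v \in R a -> exists x, v = a * x.
  apply: (prodv_ind (P := fun v => exists x, v = a * x))
    => [|_ _ [x ->] [z ->]|_ x /vlineP[c ->] _].
  - by exists 0; rewrite mulr0.
  - by exists (x + z); rewrite mulrDr.
  - by exists (c *: x); rewrite -scalerAl scalerAr.
have [a a_W a_max] : exists2 a, intertwines a &
    forall b, intertwines b -> (\dim (R b) <= \dim (R a))%N.
  apply: (ex_maximal (N := \dim {: A})) => [b _|]; first by rewrite dimvS ?subvf.
  by exists 0 => x; rewrite mulr0 mul0r.
have R_id : right_ideal (R a) by apply: right_ideal_mull.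
have R_j x v : v \in R a -> j x * v \in R a.
  by case/RP=> u ->; rewrite mulrA a_W -mulrA R_mem.
have [e eR e_id] := simple_right_ideal_idempotent simpleA R_id.
(* Averaging makes [e] commute with j(E); it stays a left identity of [R a] because j(E) stabilizes
   [R a]. *)
pose p := \sum_(q <- sE) j q.1 * e * j q.2.
have p_j x : p * j x = j x * p.
  rewrite /p big_distrr big_distrl /=; symmetry.
  transitivity (\sum_(q <- sE) j (x * q.1) * e * j q.2).
    by apply: eq_bigr => q _; rewrite j_hom.2 !mulrA.
  rewrite (sepE.1 x _ (fun u v => j u * e * j v)).
    by apply: eq_bigr => q _; rewrite j_hom.2 !mulrA.
  split=> [v|u] c f g; first by rewrite linearP !mulrDl -!scalerAl.
  by rewrite linearP mulrDr -scalerAr.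
have pR : p \in R a.
  by rewrite memv_suml // => q _; rewrite -mulrA R_j // (right_idealP _ R_id).
have p_id v : v \in R a -> p * v = v.
  move=> vR; rewrite big_distrl -[RHS]mul1r -j_hom.1 -sepE.2 linear_sum big_distrl /=.
  by apply: eq_bigr => q _; rewrite j_hom.2 -!mulrA e_id // R_j.
have aR : a \in R a by rewrite -[X in X \in _]mulr1 R_mem.
have [p1|p1] := eqVneq p 1.
  have [x ax] : exists x, 1 = a * x by apply: RP; rewrite -p1.
  by exists a => //; apply: (right_inverse_unit (x := x)).
have [c c0] : exists c, (1 - p) * average c != 0.
  by apply: average_neq0; rewrite subr_eq0 eq_sym.
set w := average c in c0; have wW : intertwines w by apply: average_intertwines.
pose b := (1 - p) * w.
have bW : intertwines b.
  by move=> x; rewrite -mulrA -wW !mulrA; congr (_ * w); rewrite mulrBl mulrBr mul1r mulr1 p_j.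
have p_b : p * b = 0 by rewrite mulrA mulrBr mulr1 p_id // subrr mul0r.
have [z zZ def_p] := centralizer_embedding j_hom j_indep p_j.
(* The counterpart of [p] in the span of j'(E), so that intertwiners carry [p] to [p']. As
   [p * b = 0], this recovers [a] as [(a + b) * p']. *)
pose p' := \sum_k z k * j' y`_k.
have swap u : intertwines u -> u * p' = p * u.
  move=> uW; rewrite def_p big_distrl big_distrr; apply: eq_bigr => k _ /=.
  by rewrite -mulrA uW !mulrA (memv_center _ (zZ k)).
have abW : intertwines (a + b) by move=> x; rewrite mulrDr mulrDl a_W bW.
have a_ab : a = (a + b) * p' by rewrite swap // mulrDr p_b addr0 p_id.
have sub_R : (R a <= R (a + b)%R)%VS.
  by apply/subvP=> _ /RP[x ->]; rewrite {1}a_ab -mulrA R_mem.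
have b_ab : b \in R (a + b).
  have abR : a + b \in R (a + b) by have := R_mem (a + b) 1; rewrite mulr1.
  by have := memvB abR (subvP sub_R _ aR); rewrite [a + b - a]addrC addKr.
have eqR : R a = R (a + b).
  by apply/eqP; rewrite -(dimv_leqif_eq sub_R) eqn_leq a_max // dimvS.
case/eqP: c0; by rewrite -/b -[b]p_id ?eqR.
Qed.

End SkolemNoether.
End Embeddings.

(** * Isotopic embeddings into H(B, tau) *)

Section Norm.
Variables (F : fieldType) (E : falgType F).

Lemma alg_norm1 : alg_norm (1 : E) = 1.
Proof.
rewrite /alg_norm rmorph1 passmx.mxof1 ?det1 //.
exact: basis_free (vbasisP _).
Qed.

Lemma alg_normM (x y : E) : alg_norm (x * y) = alg_norm x * alg_norm y.
Proof.
rewrite /alg_norm rmorphM -FalgLfun.lfun_compE -det_mulmx; congr (\det _).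
by apply: passmx.mxof_comp; apply: vbasisP.
Qed.

Lemma alg_normZ c (x : E) : alg_norm (c *: x) = c ^+ \dim {: E} * alg_norm x.
Proof. by rewrite /alg_norm linearZ (linear_isZ (passmx.mxof_linear _ _)) detZ. Qed.

End Norm.

(** * Invertibility and structure transformations in H(B, tau) *)

Section Hermitian.
Variables (F : fieldType) (B : falgType F) (tau : 'End(B)).
Hypothesis tau_inv : involution tau.
Implicit Types (g : B) (h p : herm_alg tau).

Let tauM x y : tau (x * y) = tau y * tau x. Proof. exact: tau_inv.1. Qed.
Let tauK x : tau (tau x) = x. Proof. exact: tau_inv.2. Qed.

Lemma involution1 : tau 1 = 1.
Proof. by rewrite -[LHS]mulr1 -{2}(tauK 1) -tauM mulr1 tauK. Qed.

Lemma involution_unit g : g \is a GRing.unit -> tau g \is a GRing.unit.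
Proof.
move=> gU; apply: (right_inverse_unit (x := tau g^-1)).
by rewrite -tauM mulVr // involution1.
Qed.

Lemma involutionV g : g \is a GRing.unit -> tau g^-1 = (tau g)^-1.
Proof.
move=> gU; apply: (mulrI (involution_unit gU)).
by rewrite -tauM mulVr // involution1 divrr // involution_unit.
Qed.

Lemma herm_fixed h : tau (vsval h) = vsval h.
Proof. exact/fixedSpaceP/subvsP. Qed.

Lemma herm_inj h h' : vsval h = vsval h' -> h = h'.
Proof. exact: val_inj. Qed.

Definition herm_map (c : F) g : 'End(herm_alg tau) :=
  (linfun (vsproj (fixedSpace tau)) \o (c *: (amull g \o amulr (tau g))) \o linfun vsval)%VF.

Lemma herm_mapE c g h : vsval (herm_map c g h) = c *: (g * vsval h * tau g).
Proof.
rewrite !comp_lfunE scale_lfunE comp_lfunE !lfunE /= mulrA vsprojK //.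
by apply/fixedSpaceP; rewrite linearZ /= !tauM tauK herm_fixed mulrA.
Qed.

Lemma herm_map_bij c g : c != 0 -> g \is a GRing.unit -> bijective (herm_map c g).
Proof.
move=> c0 gU; have tgU := involution_unit gU.
exists (herm_map c^-1 g^-1) => h; apply: herm_inj; rewrite !herm_mapE involutionV //.
  rewrite -scalerAr -scalerAl scalerA mulVf // scale1r !mulrA mulVr // mul1r.
  by rewrite -mulrA divrr // mulr1.
rewrite -scalerAr -scalerAl scalerA divff // scale1r !mulrA divrr // mul1r.
by rewrite -mulrA mulVr // mulr1.
Qed.

Lemma jinvertible_unit p : jinvertible p -> vsval p \is a GRing.unit.
Proof.
case=> u _ Uu; apply: (right_inverse_unit (x := vsval (u (jone _)) * vsval p)).
by rewrite mulrA -herm_algE // Uu herm_alg1.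
Qed.

Lemma unit_jinvertible p : vsval p \is a GRing.unit -> jinvertible p.
Proof.
move=> pU; apply: (eq_bij (herm_map_bij (oner_neq0 F) pU)) => h.
by apply: herm_inj; rewrite herm_mapE herm_algE // scale1r herm_fixed.
Qed.

Lemma val_jinv p : jinvertible p -> vsval (jinv p) = (vsval p)^-1.
Proof.
move=> p_inv; have pU := jinvertible_unit p_inv.
have ker0 : lker (jU p) == 0%VS by apply/lker0P; apply: bij_inj.
have /(congr1 vsval) : jU p (jinv p) = p by apply: lker0_lfunVK.
rewrite herm_algE // => e; apply: (mulrI pU); apply: (mulIr pU).
by rewrite e divrr // mul1r.
Qed.

Lemma herm_map_Str c g : c != 0 -> g \is a GRing.unit -> in_Str (herm_map c g).
Proof.
move=> c0 gU; have tgU := involution_unit gU.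
split; last exact: herm_map_bij.
(* A homomorphism into the [P]-isotope sends 1 to the inverse of [P], so [P] must be the inverse of
   [c *: (g * tau g)]. *)
pose P := c^-1 *: ((tau g)^-1 * g^-1).
have P_herm : P \in fixedSpace tau.
  by apply/fixedSpaceP; rewrite /P linearZ /= tauM -!involutionV ?tauK.
have PU : P \is a GRing.unit.
  apply: (right_inverse_unit (x := c *: (g * tau g))).
  rewrite -scalerAl -scalerAr scalerA mulVf // scale1r.
  by rewrite -mulrA mulKr // mulVr.
exists (vsproj _ P); have p_inv : jinvertible (vsproj (fixedSpace tau) P : herm_alg tau).
  by apply: unit_jinvertible; rewrite vsprojK.
have PV : P^-1 = c *: (g * tau g).
  apply: (mulrI PU); rewrite divrr // -scalerAl -scalerAr scalerA mulVf // scale1r.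
  by rewrite -mulrA mulKr // mulVr.
split=> //; split=> [|x y]; apply: herm_inj.
  by rewrite [RHS]val_jinv // vsprojK // herm_mapE herm_alg1 // mulr1 PV.
have PE : c *: (tau g * P * g) = 1.
  by rewrite -scalerAr -scalerAl scalerA divff // scale1r mulrA divrr // mul1r mulVr.
rewrite herm_mapE [in RHS]comp_lfunE !herm_algE // vsprojK // !herm_mapE.
transitivity (c *: (g * vsval x * (c *: (tau g * P * g)) * vsval y
  * (c *: (tau g * P * g)) * vsval x * tau g)).
  by rewrite PE !mulr1 !mulrA.
clearbody P; by do ![rewrite -scalerAl | rewrite -scalerAr]; rewrite !mulrA.
Qed.

Section Embedding.
Variable E : falgType F.
Implicit Types i : 'Hom(plus_alg E, herm_alg tau).

(** In the [p]-isotope, i(xyx) = i(x) p i(y) p i(x); multiplying by [p] on the right makes j(x) =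
    i(x) p a unital Jordan homomorphism into [B], and [a] is the inverse of [p]. *)
Lemma isotopic_embedding_alg_hom i : etale E -> isotopic_embedding i ->
  exists (a : B) (j : 'Hom(E, B)),
    [/\ a \is a GRing.unit, tau a = a, alg_hom j, injective j
      & forall x : E, vsval (i x) = j x * a].
Proof.
move=> etE [[p [p_inv [i1 iU]]] i_inj]; have pU := jinvertible_unit p_inv.
pose j : 'Hom(E, B) := (amulr (vsval p) \o linfun vsval \o i)%VF.
have jE x : j x = vsval (i x) * vsval p by rewrite !comp_lfunE !lfunE.
have i1E : vsval (i (1 : E)) = (vsval p)^-1 by rewrite -val_jinv //; exact: congr1 i1.
have j1 : j 1 = 1 by rewrite jE i1E mulVr.
have jU (x y : E) : j (x * y * x) = j x * j y * j x.
  rewrite !jE -plus_algE iU [jU _ _]comp_lfunE !herm_algE //.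
  by rewrite !mulrA.
exists (vsval (i (1 : E))), j; split.
- by rewrite i1E unitrV.
- exact: herm_fixed.
- by split=> // x y; apply: (etale_jordan_hom (j := j)) => //; apply: linearP.
- move=> x y; rewrite !jE => /(mulIr pU) /(@herm_inj _ _) /i_inj; exact.
- by move=> x; rewrite jE i1E mulrK.
Qed.

Variables (i i' : 'Hom(plus_alg E, herm_alg tau)) (a : B) (j : 'Hom(E, B)).
Hypothesis commE : commutative ( *%R : E -> E -> E).
Hypothesis j_hom : alg_hom j.
Hypothesis iE : forall x : E, vsval (i x) = j x * a.

(** Both [a] and [j x * a] are hermitian, being the values of [i] at 1 and at [x]. *)
Lemma embedding_conj x : a * tau (j x) = j x * a.
Proof.
have tau_a : tau a = a by rewrite -[a]mul1r -j_hom.1 -iE herm_fixed.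
by rewrite -{1}tau_a -tauM -iE herm_fixed.
Qed.

Lemma alg_hom_unit x : x \is a GRing.unit -> j x \is a GRing.unit.
Proof.
by move=> xU; apply: (right_inverse_unit (x := j x^-1)); rewrite -j_hom.2 divrr ?j_hom.1.
Qed.

(* With n = N(w0), the element w0 ^ 3 / n has norm 1, and the extra factor
   w0 ^ 2 / n comes from the structure transformation h |-> n^-1 (j w0) h tau(j w0). *)
Lemma norm_one_correction (b : B) (w0 : E) :
    \dim {: E} = 3 -> b \is a GRing.unit -> w0 \is a GRing.unit ->
    (forall x : E, b * vsval (i' x) * tau b = vsval (i (x * w0 : E))) ->
  exists w : E, alg_norm w = 1 /\
  exists phi : 'End(herm_alg tau), in_Str phi /\
    (phi \o i' = i \o (amulr w : 'End(plus_alg E)))%VF.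
Proof.
move=> dimE bU w0U b_i'; pose n := alg_norm w0.
have n0 : n != 0.
  by apply/eqP=> n0; have /eqP := alg_normM w0 w0^-1; rewrite divrr // alg_norm1 -/n n0 mul0r oner_eq0.
have nV0 : n^-1 != 0 by rewrite invr_eq0.
exists (n^-1 *: w0 ^+ 3); split.
  rewrite alg_normZ dimE exprS expr2 !alg_normM -/n.
  by rewrite -expr2 -exprS -exprMn mulVf // expr1n.
have gU : j w0 * b \is a GRing.unit by rewrite unitrMl // alg_hom_unit.
exists (herm_map n^-1 (j w0 * b)); split; first exact: herm_map_Str.
apply/lfunP=> x; apply: herm_inj; rewrite comp_lfunE herm_mapE comp_lfunE tauM !mulrA.
transitivity (n^-1 *: (j w0 * (b * vsval (i' x) * tau b) * tau (j w0))).
  by rewrite !mulrA.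
rewrite b_i' iE lfunE /= -scalerAr linearZ /=.
rewrite iE -!mulrA embedding_conj !mulrA -!j_hom.2; congr (_ *: (j _ * _)).
by rewrite [w0 * (x * w0)]commE.
Qed.

End Embedding.
End Hermitian.

(** * The center under a unitary involution, and descent of coefficients to [F] *)

Lemma etale_center_separability (F : fieldType) (B : falgType F) :
    etale (subvs_of 'Z({: B})) ->
  exists sZ : seq (B * B),
    [/\ forall z, z \in 'Z({: B})%VS -> casimir_comm sZ z,
        \sum_(p <- sZ) p.1 * p.2 = 1
      & forall p, p \in sZ -> (p.1 \in 'Z({: B})%VS) && (p.2 \in 'Z({: B})%VS)].
Proof.
move=> /etale_separability_seq[s [s_comm s_sum]].
exists [seq (vsval p.1, vsval p.2) | p <- s]; split.
- move=> z zZ W b b_bil; rewrite !big_map /=.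
  have val_lin : linear (vsval : subvs_of 'Z({: B})%VS -> B) by apply: linearP.
  by have := s_comm (Subvs zZ) _ _ (bilinear_comp val_lin val_lin b_bil).
- rewrite big_map /=; have := congr1 vsval s_sum; rewrite linear_sum /= => ->.
  by rewrite algid_center; apply/eqP; rewrite algid_eq1 memvf.
- by move=> _ /mapP[p _ ->] /=; rewrite !subvsP.
Qed.

Lemma center_not_zero_divisor (F : fieldType) (B : falgType F) (z x : B) :
  simple_alg B -> z \in 'Z({: B})%VS -> z * x = 0 -> z != 0 -> x = 0.
Proof.
move=> simpleB /memv_center zC zx0 z0; have [s sum_s] := simple_unit_sum simpleB z0.
rewrite -[x]mul1r -sum_s big_distrl big1 //= => p _.
by rewrite -(zC p.1) -!mulrA zC -!mulrA -(zC x) zx0 !mulr0.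
Qed.

Section Unitary.
Variables (F : fieldType) (B : falgType F) (tau : 'End(B)) (E : falgType F).
Hypothesis tau_inv : involution tau.
Local Notation Z := ('Z({: B}))%VS.

Let tauM x y : tau (x * y) = tau y * tau x. Proof. exact: tau_inv.1. Qed.
Let tauK x : tau (tau x) = x. Proof. exact: tau_inv.2. Qed.

Lemma involution_center z : z \in Z -> tau z \in Z.
Proof.
by move/memv_center=> zC; apply/memv_center=> x; rewrite -[x]tauK -!tauM zC.
Qed.

Variable z0 : B.
Hypotheses (simpleB : simple_alg B) (dimZ : \dim Z = 2).
Hypotheses (z0Z : z0 \in Z) (tau_z0 : tau z0 <> z0).

(** The fixed part of the two-dimensional center contains [F] and omits [z0], so it has dimension
    1. *)
Lemma center_fixed z : z \in Z -> tau z = z -> exists c : F, z = c%:A.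
Proof.
move=> zZ tau_z; suff: z \in 1%VS by move/vlineP.
have -> : 1%VS = (Z :&: fixedSpace tau)%VS; last by rewrite memv_cap zZ; apply/fixedSpaceP.
apply/eqP; rewrite eqEdim; apply/andP; split.
  by rewrite -memvE memv_cap center1; apply/fixedSpaceP/involution1.
have: (\dim (Z :&: fixedSpace tau) < \dim Z)%N; last by rewrite dimZ dimv1 ltnS.
rewrite ltn_neqAle dimvS ?capvSl // andbT (dimv_leqif_eq (capvSl _ _)).
apply/eqP=> eqZ; apply: tau_z0.
by move: z0Z; rewrite -eqZ memv_cap => /andP[_ /fixedSpaceP].
Qed.

Variables (a : B) (j : 'Hom(E, B)).
Hypotheses (aU : a \is a GRing.unit) (j_inj : injective j).
Hypothesis j_conj : forall x, a * tau (j x) = j x * a.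

(** The involution y |-> a tau(y) a^-1 fixes j(E) and sends a relation with coefficients [z k] to
    one with coefficients [tau (z k)]. Their sum has coefficients in [F], which vanish because [j]
    is injective. *)
Lemma hermitian_center_independent : center_independent j.
Proof.
have free_F (c : 'I_(\dim {: E}) -> F) : \sum_k c k *: j (vbasis {: E})`_k = 0 -> forall k, c k = 0.
  move=> sum0; have /freeP := basis_free (vbasisP {: E}); apply.
  by apply: j_inj; rewrite linear0 linear_sum -[RHS]sum0; apply: eq_bigr => k _; rewrite linearZ.
have tau_rel (z : 'I_(\dim {: E}) -> B) : (forall k, z k \in Z) ->
    \sum_k z k * j (vbasis {: E})`_k = 0 -> \sum_k tau (z k) * j (vbasis {: E})`_k = 0.
  move=> zZ sum0; apply: (mulIr aU); rewrite mul0r big_distrl /=.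
  transitivity (a * tau (\sum_k z k * j (vbasis {: E})`_k)); last by rewrite sum0 linear0 mulr0.
  rewrite linear_sum big_distrr /=.
  apply: eq_bigr => k _; rewrite tauM mulrA j_conj -mulrA.
  by rewrite (memv_center _ (involution_center (zZ k))).
have anti (z : 'I_(\dim {: E}) -> B) : (forall k, z k \in Z) ->
    \sum_k z k * j (vbasis {: E})`_k = 0 -> forall k, tau (z k) = - z k.
  move=> zZ sum0 k.
  have tZ m : z m + tau (z m) \in Z by rewrite memvD // involution_center.
  have /fin_all_exists[c tE] m : exists c : F, z m + tau (z m) = c%:A.
    by apply: center_fixed => //; rewrite linearD /= tauK addrC.
  suff ck : c k = 0 by apply/eqP; rewrite -addr_eq0 addrC tE ck scale0r.
  apply: free_F.
  transitivity (\sum_k z k * j (vbasis {: E})`_k + \sum_k tau (z k) * j (vbasis {: E})`_k).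
    by rewrite -big_split; apply: eq_bigr => m _; rewrite /= -mulrDl tE -scalerAl mul1r.
  by rewrite sum0 tau_rel // addr0.
move=> z zZ sum0 k; have tz := anti z zZ sum0 k.
have z0z : forall m, z0 * z m \in Z.
  move=> m; apply/memv_center=> x.
  by rewrite -mulrA (memv_center _ (zZ m)) mulrA (memv_center _ z0Z) mulrA.
(* The relation multiplied by [z0] is again a relation; comparing the two sign rules gives
   [z k * (z0 - tau z0) = 0]. *)
have := anti (fun m => z0 * z m) z0z _ k.
rewrite tauM tz mulNr (memv_center _ z0Z) => h; apply/eqP.
have {}h : z k * (z0 - tau z0) = 0.
  rewrite mulrBr; apply/eqP; rewrite subr_eq0 -(inj_eq oppr_inj); apply/eqP.
  rewrite h //; transitivity (z0 * \sum_m z m * j (vbasis {: E})`_m); last by rewrite sum0 mulr0.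
  by rewrite big_distrr; apply: eq_bigr => m _; rewrite /= mulrA.
apply/negPn/negP=> zk0.
have := center_not_zero_divisor simpleB (zZ k) h zk0.
by move/eqP; rewrite subr_eq0 eq_sym => /eqP.
Qed.

(** By independence over the center, invariance of [u] forces every coefficient to be fixed by
    [tau], hence to lie in [F]. *)
Lemma unitary_fixed_embedding u (z : 'I_(\dim {: E}) -> B) :
    (forall k, z k \in Z) -> u = \sum_k z k * j (vbasis {: E})`_k ->
    a * tau u = u * a -> exists w0, u = j w0.
Proof.
move=> zZ def_u u_conj.
have sum0 : \sum_k (tau (z k) - z k) * j (vbasis {: E})`_k = 0.
  apply: (mulIr aU); rewrite mul0r.
  under eq_bigr do rewrite mulrBl.
  rewrite sumrB -def_u mulrBl -u_conj def_u linear_sum big_distrl big_distrr /=.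
  rewrite -sumrB big1 // => k _; rewrite tauM mulrA j_conj -mulrA.
  by rewrite -[in LHS]mulrA (memv_center _ (involution_center (zZ k))) -!mulrA subrr.
have tz k : tau (z k) = z k.
  apply/eqP; rewrite -subr_eq0; apply/eqP.
  apply: (hermitian_center_independent _ sum0 k) => m.
  by rewrite memvB // involution_center.
have /fin_all_exists[c zE] k : exists c : F, z k = c%:A by apply: center_fixed.
exists (\sum_k c k *: (vbasis {: E})`_k); rewrite def_u linear_sum.
by apply: eq_bigr => k _; rewrite zE linearZ -scalerAl mul1r.
Qed.

End Unitary.

(** * The two cases: [B] simple, and the exchange involution *)

Section Cases.
Variables (F : fieldType) (B : falgType F) (tau : 'End(B)) (E : falgType F).
Hypotheses (tau_inv : involution tau) (etE : etale E) (dimE : \dim {: E} = 3).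
Variables (i i' : 'Hom(plus_alg E, herm_alg tau)).
Hypotheses (hi : isotopic_embedding i) (hi' : isotopic_embedding i').

Let conclusion : Prop := exists w : E, alg_norm w = 1 /\
  exists phi : 'End(herm_alg tau), in_Str phi /\
    (phi \o i' = i \o (amulr w : 'End(plus_alg E)))%VF.

Lemma simple_case : etale (subvs_of 'Z({: B})) -> \dim 'Z({: B}) = 2 ->
    (exists2 z, z \in 'Z({: B})%VS & tau z <> z) -> simple_alg B ->
    \dim {: B} = (3 ^ 2 * \dim 'Z({: B}))%N -> conclusion.
Proof.
move=> etZ dimZ [z0 z0Z tau_z0] simpleB dimB.
have commE := etale_comm etE.
have [sE sepE] := etale_separability_seq etE.
have [sZ [sZ_comm sZ_sum sZ_center]] := etale_center_separability etZ.
have [a [j [aU tau_a j_hom j_inj iE]]] := isotopic_embedding_alg_hom tau_inv etE hi.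
have [a' [j' [a'U tau_a' j'_hom j'_inj i'E]]] := isotopic_embedding_alg_hom tau_inv etE hi'.
have j_conj := embedding_conj tau_inv j_hom iE.
have j'_conj := embedding_conj tau_inv j'_hom i'E.
have indep := hermitian_center_independent tau_inv simpleB dimZ z0Z tau_z0.
have j_indep := indep _ _ _ aU j_inj j_conj.
have j'_indep := indep _ _ _ a'U j'_inj j'_conj.
have dimBn : \dim {: B} = (\dim {: E} ^ 2 * \dim 'Z({: B}))%N by rewrite dimE.
have [b bU jb] := skolem_noether simpleB dimBn commE sepE sZ_comm sZ_sum sZ_center
  j_hom j'_hom j_indep j'_indep.
have tbU := involution_unit tau_inv bU.
(* Chosen so that [b * vsval (i' x) * tau b = j x * u * a]. *)
pose u := b * a' * tau b * a^-1.
have u_j x : u * j x = j x * u.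
  have tj : tau b * tau (j x) = tau (j' x) * tau b by rewrite -!tau_inv.1 jb.
  have a_j : a^-1 * j x = tau (j x) * a^-1.
    by apply: (mulrI aU); rewrite mulVKr // mulrA j_conj mulrK.
  rewrite /u -mulrA a_j mulrA -[_ * tau b * _]mulrA tj -!mulrA.
  rewrite [a' * (tau (j' x) * _)]mulrA j'_conj.
  by rewrite -!mulrA [b * (j' x * _)]mulrA -jb !mulrA.
have [z zZ def_u] := centralizer_embedding simpleB dimBn commE sepE sZ_comm sZ_sum sZ_center
  j_hom j_indep u_j.
have u_conj : a * tau u = u * a.
  rewrite /u mulrVK // !tau_inv.1 involutionV // tau_a tau_a' tau_inv.2.
  by rewrite mulVKr // mulrA.
have [w0 def_w0] := unitary_fixed_embedding tau_inv simpleB dimZ z0Z tau_z0 aU j_inj j_conj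
  zZ def_u u_conj.
have uU : u \is a GRing.unit by rewrite !unitrMl ?unitrV.
(* The inverse of [u] is only known in [B]; invertibility in [E] comes from injectivity of
   multiplication by [w0] and finite dimension. *)
have w0U : w0 \is a GRing.unit.
  have ker0 : lker (amulr w0) == 0%VS.
    apply/lker0P=> x y; rewrite !lfunE /= => /(congr1 j); rewrite !j_hom.2 -def_w0.
    by move/(mulIr uU)/j_inj.
  have /memv_imgP[x _] : 1 \in limg (amulr w0) by rewrite (lker0_limgf ker0) memvf.
  by rewrite lfunE /= commE => /esym; apply: right_inverse_unit.
apply: (norm_one_correction tau_inv commE j_hom iE dimE bU w0U) => x.
by rewrite i'E iE j_hom.2 -def_w0 /u mulrA -jb -!mulrA mulVr // mulr1.
Qed.

(** Under [f] the hermitian elements are the pairs (x, x), so they can be compared in the first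
    factor, which is central simple over [F]. *)
Lemma exchange_case (A : falgType F) (f : 'Hom(B, (A * A)%type)) :
  central_simple3 A -> exchange_iso tau f -> conclusion.
Proof.
move=> [simpleA ZA dimA] [f_bij f1 fM f_tau].
have commE := etale_comm etE.
have [sE sepE] := etale_separability_seq etE.
have [a [j [aU tau_a j_hom j_inj iE]]] := isotopic_embedding_alg_hom tau_inv etE hi.
have [a' [j' [a'U tau_a' j'_hom j'_inj i'E]]] := isotopic_embedding_alg_hom tau_inv etE hi'.
have f_inj := bij_inj f_bij.
have fix_eq x : tau x = x -> (f x).2 = (f x).1.
  by move=> tx; have := f_tau x; rewrite tx => {1}->.
have f_unit x : x \is a GRing.unit -> (f x).1 \is a GRing.unit.
  move=> xU; apply: (right_inverse_unit (x := (f x^-1).1)).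
  by have := fM x x^-1; rewrite divrr // f1 => -[].
pose pr : 'Hom((A * A)%type, A) := linfun fst.
have prE x : pr x = x.1 by rewrite lfunE.
have fst_hom (k : 'Hom(E, B)) : alg_hom k -> alg_hom (pr \o f \o k)%VF.
  move=> [k1 kM]; split=> [|x y]; rewrite !comp_lfunE !prE ?k1 ?f1 //.
  by rewrite kM fM.
have fst_indep (k : 'Hom(E, B)) (c : B) (i0 : 'Hom(plus_alg E, herm_alg tau)) :
    c \is a GRing.unit -> injective k -> (forall x : E, vsval (i0 x) = k x * c) ->
  center_independent (pr \o f \o k)%VF.
  move=> cU k_inj kE z zZ sum0.
  have /fin_all_exists[l zE] m : exists c : F, z m = c%:A.
    by have := zZ m; rewrite ZA => /vlineP.
  (* The hermitian element [k x * c] has equal components, so it vanishes as soon as the first one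
     does. *)
  have fst0 x : (f (k x)).1 = 0 -> x = 0.
    move=> fk0; have f0 : (f (k x * c)).1 = 0 by rewrite fM /= fk0 mul0r.
    apply: k_inj; rewrite linear0; apply: (mulIr cU); rewrite mul0r.
    apply: f_inj; rewrite linear0 [LHS]surjective_pairing fix_eq ?f0 //.
    by rewrite -kE herm_fixed.
  have l0 : forall m, l m = 0.
    have /freeP := basis_free (vbasisP {: E}); apply; apply: fst0.
    rewrite -prE -[RHS]sum0 !linear_sum; apply: eq_bigr => m _.
    by rewrite !comp_lfunE /= !linearZ /= zE -scalerAl mul1r.
  by move=> m; rewrite zE l0 scale0r.
have dimAn : \dim {: A} = (\dim {: E} ^ 2 * \dim 'Z({: A}))%N by rewrite dimE ZA dimv1.
have [b bU jb] : exists2 b, b \is a GRing.unit & forall x, (f (j x)).1 * b = b * (f (j' x)).1.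
  (* The center of [A] is [F], whose separability idempotent is 1 (x) 1. *)
  have one_comm z : z \in 'Z({: A})%VS -> casimir_comm [:: (1, 1)] z.
    by rewrite ZA => /vlineP[c ->]; apply: casimir_comm_alg.
  have one_sum : \sum_(p <- [:: (1, 1)]) p.1 * p.2 = 1 :> A by rewrite big_seq1 mulr1.
  have one_center p : p \in [:: (1, 1)] -> (p.1 \in 'Z({: A})%VS) && (p.2 \in 'Z({: A})%VS).
    by rewrite inE => /eqP->; rewrite center1.
  have [b bU jb] := skolem_noether simpleA dimAn commE sepE one_comm one_sum one_center
    (fst_hom _ j_hom) (fst_hom _ j'_hom) (fst_indep _ _ _ aU j_inj iE)
    (fst_indep _ _ _ a'U j'_inj i'E).
  by exists b => // x; have := jb x; rewrite !comp_lfunE !prE.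
have [finv finvK fK] := f_bij.
have sU := f_unit a aU; have s'U := f_unit a' a'U.
set s := (f a).1 in sU; set s' := (f a').1 in s'U.
(* The second component of [g] is free; this choice solves [b * s' * g2 = b * b^-1 * s], so that
   conjugation by [g] turns [i'] into [i] with no correcting factor. *)
pose g2 := s'^-1 * b^-1 * s; pose g := finv (b, g2).
have g2U : g2 \is a GRing.unit by rewrite !unitrMl ?unitrV.
have fg : f g = (b, g2) by rewrite fK.
have gU : g \is a GRing.unit.
  apply: (right_inverse_unit (x := finv (b^-1, g2^-1))); apply: f_inj.
  by rewrite fM fg fK /= f1 divrr // mulVr.
apply: (norm_one_correction (w0 := 1) tau_inv commE j_hom iE dimE gU (unitr1 E)) => x.
apply: f_inj; rewrite mulr1 [LHS]surjective_pairing [RHS]surjective_pairing.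
have val_fix (y : herm_alg tau) : (f (vsval y)).2 = (f (vsval y)).1 by rewrite fix_eq ?herm_fixed.
have e1 : (f (g * vsval (i' x) * tau g)).1 = (f (vsval (i x))).1.
  rewrite i'E iE !fM /= f_tau fg /= -/s -/s' mulrA -jb /g2.
  by rewrite -!mulrA mulVKr // mulVKr.
by rewrite val_fix -e1 !fM /= f_tau fg /= val_fix !mulrA.
Qed.

End Cases.

Theorem theorem5p2p7 (F : fieldType) (B : falgType F) (tau : 'End(B))
    (E : falgType F)
    (hB : unitary_central_simple3 tau) (hE : cubic_etale E)
    (i i' : 'Hom(plus_alg E, herm_alg tau))
    (hi : isotopic_embedding i) (hi' : isotopic_embedding i') :
  exists w : E, alg_norm w = 1 /\
  exists phi : 'End(herm_alg tau), in_Str phi /\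
    (phi \o i' = i \o (amulr w : 'End(plus_alg E)))%VF.
Proof.
case: hE => etE dimE; case: hB => tau_inv etZ dimZ z_moved [[simpleB dimB]|[A [f [csA f_ex]]]].
  exact: simple_case.
exact: exchange_case csA f_ex.
Qed.
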